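(* Let $G_p$ and $G_c$ be IF-OFP systems with passivity indices $(\nu_p,\rho_p)$ and $(\nu_c,\rho_c)$ respectively, interconnected in the two-sided event-triggered feedback loop described in the context, where the triggering instants $t_{p_k}$ and $t_{c_k}$ are determined by the conditions $\|e_p(t)\|_2^2>\delta_p\|y_p(t)\|_2^2$ with $\delta_p\in(0,1]$ and $\|e_c(t)\|_2^2>\delta_c\|y_c(t)\|_2^2$ with $\delta_c\in(0,1]$, respectively. Let $$\beta(\nu_p)=\begin{cases}\rho_c-\nu_p-\delta_c(1+\nu_p)&\text{if }\nu_p>0,\\ \rho_c-\delta_c&\text{if }\nu_p=0,\\ \rho_c+2\nu_p-\delta_c(1-3\nu_p)&\text{if }\nu_p<0,\end{cases}\qquad \beta(\nu_c)=\begin{cases}\rho_p-\nu_c-\delta_p(1+\nu_c)&\text{if }\nu_c>0,\\ \rho_p-\delta_p&\text{if }\nu_c=0,\\ \rho_p+2\nu_c-\delta_p(1-3\nu_c)&\text{if }\nu_c<0.\end{cases}$$ Then the networked control system is passive from the inputs $w=\begin{bmatrix} w_1 \\ w_2 \end{bmatrix}$ to the outputs $y=\begin{bmatrix} y_p \\ y_c \end{bmatrix}$ with input passivity index $\epsilon_0$ and output passivity index $\delta_0$, that is, $$\dot V(t)\le w^T(t)y(t)-\epsilon_0\,w^T(t)w(t)-\delta_0\,y^T(t)y(t)$$ for a storage function $V$ of the interconnection, where $$\epsilon_0<\min(\nu_c-|\nu_c|,\ \nu_p-|\nu_p|),\qquad \delta_0<\min\Big(\beta(\nu_c)-\frac14-\frac{\nu_c^2}{\nu_c-|\nu_c|-\epsilon_0},\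 \beta(\nu_p)-\frac14-\frac{\nu_p^2}{\nu_p-|\nu_p|-\epsilon_0}\Big).$$
   Context: Systems: a system $G$ has the form $\dot x=f(x,u)$, $y=h(x,u)$ with state $x\in X\subset\mathbb{R}^n$ and $u(t),y(t)\in\mathbb{R}^m$. A storage function is a nonnegative function $V$ of the state; it is taken differentiable, and $\dot V(t)$ is the time derivative along solutions. $G$ is IF-OFP (input feed-forward output feedback passive) with input passivity index $\nu\in\mathbb{R}$ and output passivity index $\rho\in\mathbb{R}$ (of either sign) if there is a storage function $V$ with $\dot V\le u^Ty-\rho y^Ty-\nu u^Tu$ for all $t$ along all solutions. Two-sided event-triggered loop: $G_p$ (plant, state $x_p$, input $u_p$, output $y_p$) has indices $(\nu_p,\rho_p)$, and $G_c$ (controller, state $x_c$, input $u_c$, output $y_c$) has indices $(\nu_c,\rho_c)$; all inputs and outputs are $\mathbb{R}^m$-valued. External signals $w_1,w_2$ are $\mathbb{R}^m$-valued. At event instants $t_{p_k}$ the plant output is sampled, sent to the controller and held until the next plant event; at event instants $t_{c_k}$ the controller output is sampled, sent to the plant and held until the next controller event. With $e_p(t)=y_p(t)-y_p(t_{p_k})$ for $t\in[t_{p_k},t_{p_{k+1}})$ and $e_c(t)=y_c(t)-y_c(t_{c_k})$ for $t\in[t_{c_k},t_{c_{k+1}})$, the inputs are $u_c(t)=w_2(t)+y_p(t_{p_k})=w_2(t)+y_p(t)-e_p(t)$ and $u_p(t)=w_1(t)-y_c(t_{c_k})=w_1(t)+e_c(t)-y_c(t)$. A new plant (resp. controller) event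 is triggered as soon as $\|e_p(t)\|_2^2>\delta_p\|y_p(t)\|_2^2$ (resp. $\|e_c(t)\|_2^2>\delta_c\|y_c(t)\|_2^2$), Euclidean norms at time $t$, so that $e_p^Te_p\le\delta_p y_p^Ty_p$ and $e_c^Te_c\le\delta_c y_c^Ty_c$ hold at all times. A storage function of the interconnection is a nonnegative function $V$ of $(x_p,x_c)$; inequalities on $\dot V$ are required along all solutions for all $t$ in the inter-event intervals. The indices $\epsilon_0,\delta_0$ may be of either sign. *)

(* Defs.v *)
From HB Require Import structures.
From mathcomp Require Import all_boot all_order all_algebra.
From mathcomp Require Import all_classical all_reals all_analysis.

Set Implicit Arguments.
Unset Strict Implicit.
Unset Printing Implicit Defensive.

Import Order.TTheory GRing.Theory Num.Theory.
Import numFieldNormedType.Exports.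

Local Open Scope classical_set_scope.
Local Open Scope ring_scope.

Definition dotv (R : realType) (m : nat) (u v : 'cV[R]_m) : R := (u^T *m v) 0 0.

(* Euclidean norm; the library norm `|u| on matrices is the sup norm. *)
Definition norm2 (R : realType) (m : nat) (u : 'cV[R]_m) : R :=
  Num.sqrt (dotv u u).

Definition horizon (R : realType) (T : \bar R) : set R :=
  [set t | 0 <= t /\ (t%:E < T)%E].

Definition right_derivative (R : realType) (E : normedModType R)
    (g : R -> E) (t : R) (d : E) : Prop :=
  h^-1 *: (g (t + h) - g t) @[h --> 0^'+] --> d.

(* x' = dyn x u, y = out x u; only the values of dyn and out at states in
   state_set matter. *)
Record system (R : realType) (n m : nat) := System {
  state_set : set 'cV[R]_n;
  dyn : 'cV[R]_n -> 'cV[R]_m -> 'cV[R]_n;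
  out : 'cV[R]_n -> 'cV[R]_m -> 'cV[R]_m }.

(* Sampled-and-held inputs are discontinuous at event instants, so solutions are
   piecewise classical: x is continuous, x' = dyn x u holds with the ordinary
   derivative except at a locally finite set of breakpoints, and at the left
   endpoint of each piece it holds with the derivative from the right. *)
Record solution (R : realType) (n m : nat) (G : system R n m) (T : \bar R)
    (x : R -> 'cV[R]_n) (u y : R -> 'cV[R]_m) : Prop := Solution {
  sol_continuous : {within horizon T, continuous x};
  sol_state : forall t, horizon T t -> state_set G (x t);
  sol_right : forall t, horizon T t ->
    right_derivative x t (dyn G (x t) (u t));
  sol_ordinary : exists2 D : set R,
    (forall s, horizon T s -> finite_set (D `&` `[0, s])) &
    (forall t, horizon T t -> 0 < t -> ~ D t ->
      is_derive t 1 x (dyn G (x t) (u t)));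
  sol_out : forall t, horizon T t -> y t = out G (x t) (u t) }.

Definition storage_function (R : realType) (E : normedModType R) (X : set E)
    (V : E -> R) : Prop :=
  forall x, X x -> 0 <= V x /\ differentiable V x.

(* The input-output system is given by its behaviour B: the trajectories
   (state x, input u, output y) on a horizon [0, T). The time derivative of V
   is taken from the right; it exists because V is differentiable, and it is the
   ordinary derivative away from the breakpoints of the trajectory. *)
Definition passive_with_indices (R : realType) (E : normedModType R) (m : nat)
    (X : set E)
    (B : \bar R -> (R -> E) -> (R -> 'cV[R]_m) -> (R -> 'cV[R]_m) -> Prop)
    (nu rho : R) : Prop :=
  exists2 V : E -> R, storage_function X V &
    forall T x u y, B T x u y -> forall t, horizon T t ->
      exists2 dV : R, right_derivative (V \o x : R -> R) t dV &
        dV <= dotv (u t) (y t) - rho * dotv (y t) (y t)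
                               - nu * dotv (u t) (u t).

Definition IF_OFP (R : realType) (n m : nat) (G : system R n m) (nu rho : R) :
    Prop :=
  passive_with_indices (state_set G) (solution G) nu rho.

(* s k is the k-th event instant, +oo if there is no k-th event before T. The
   first sample is taken at time 0 and the next event is the first time at which
   the error with respect to the last sample violates the threshold. The last
   clause says that events do not accumulate before T, so that the held signal
   is defined on the whole of [0, T). *)
Record event_instants (R : realType) (m : nat) (T : \bar R) (delta : R)
    (y : R -> 'cV[R]_m) (s : nat -> \bar R) : Prop := EventInstants {
  event_first : s 0%N = 0%E;
  event_next : forall k, s k.+1 =
    ereal_inf [set t%:E | t in [set t | [/\ (s k < t%:E)%E, (t%:E < T)%E &
      delta * norm2 (y t) ^+ 2 < norm2 (y t - y (fine (s k))) ^+ 2]]];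
  event_cover : forall t, horizon T t ->
    exists k, (s k <= t%:E)%E /\ (t%:E < s k.+1)%E }.

Definition held (R : realType) (m : nat) (T : \bar R) (y : R -> 'cV[R]_m)
    (s : nat -> \bar R) (yh : R -> 'cV[R]_m) : Prop :=
  forall k t, horizon T t -> (s k <= t%:E)%E -> (t%:E < s k.+1)%E ->
    yh t = y (fine (s k)).

(* With ep t = yp t - yp_held t and ec t = yc t - yc_held t, the inputs below are
   up = w1 + ec - yc and uc = w2 + yp - ep. *)
Definition event_triggered_loop (R : realType) (np nc m : nat)
    (Gp : system R np m) (Gc : system R nc m) (delta_p delta_c : R)
    (T : \bar R) (x : R -> 'cV[R]_np * 'cV[R]_nc)
    (w y : R -> 'cV[R]_(m + m)) : Prop :=
  let w1 t := usubmx (w t) in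
  let w2 t := dsubmx (w t) in
  let yp t := usubmx (y t) in
  let yc t := dsubmx (y t) in
  exists (tp tc : nat -> \bar R) (yp_held yc_held : R -> 'cV[R]_m),
    [/\ event_instants T delta_p yp tp, event_instants T delta_c yc tc,
        held T yp tp yp_held & held T yc tc yc_held] /\
    solution Gp T (fun t => (x t).1) (fun t => w1 t - yc_held t) yp /\
    solution Gc T (fun t => (x t).2) (fun t => w2 t + yp_held t) yc.

(* In the bound for index nu of one subsystem, rho and delta are the output index
   and the triggering parameter of the other one. *)
Definition beta (R : realType) (rho delta nu : R) : R :=
  if 0 < nu then rho - nu - delta * (1 + nu)
  else if nu == 0 then rho - delta
  else rho + 2 * nu - delta * (1 - 3 * nu).

(* Main.v *)
Require Import Defs.
From mathcomp Require Import all_boot all_order all_algebra.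
From mathcomp Require Import all_classical all_reals all_analysis.
From mathcomp Require Import ring lra.
Import Order.TTheory GRing.Theory Num.Theory.
Import numFieldNormedType.Exports.
Local Open Scope classical_set_scope.
Local Open Scope ring_scope.

(** The sum of the two storage functions is a storage function of the loop.
    Adding the two dissipation inequalities with [up = w1 - yc + ec] and
    [uc = w2 + yp - ep], the products of the outputs with each other cancel:
    [up^T yp + uc^T yc = w^T y + ec^T yp - ep^T yc].  What is left to absorb is
    - the error products, which Young's inequality bounds by
      [|ec|^2 + |yp|^2 / 4] and [|ep|^2 + |yc|^2 / 4] (whence the two terms
      [1 / 4] of the bound on the output index);
    - the feed-forward terms [- nu_p |up|^2] and [- nu_c |uc|^2].
    After this the estimate decouples into one inequality for each
    communication channel, relating the external signal, the sampled output
    and its error; this is [channel_dissipation], which accounts for the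
    shape of [beta].  The error is controlled by the triggering rule
    ([sampling_error_le]): a violation after an event instant would itself have
    caused the next event. *)

Section EuclideanProduct.
Context {R : realType} {m : nat}.
Implicit Types (u v w y e : 'cV[R]_m) (a c k nu rho delta eps : R).

Lemma dotvC u v : dotv u v = dotv v u.
Proof.
by rewrite /dotv !mxE; apply: eq_bigr => i _; rewrite !mxE mulrC.
Qed.

Lemma dotvDl u v w : dotv (u + v) w = dotv u w + dotv v w.
Proof. by rewrite /dotv linearD mulmxDl mxE. Qed.

Lemma dotvZl a u v : dotv (a *: u) v = a * dotv u v.
Proof. by rewrite /dotv linearZ -scalemxAl mxE. Qed.

Lemma dotvNl u v : dotv (- u) v = - dotv u v.
Proof. by rewrite -scaleN1r dotvZl mulN1r. Qed.

Lemma dotvDr u v w : dotv w (u + v) = dotv w u + dotv w v.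
Proof. by rewrite dotvC dotvDl !(dotvC w). Qed.

Lemma dotvZr a u v : dotv v (a *: u) = a * dotv v u.
Proof. by rewrite dotvC dotvZl dotvC. Qed.

Lemma dotvNr u v : dotv v (- u) = - dotv v u.
Proof. by rewrite dotvC dotvNl dotvC. Qed.

Definition dotvE := (dotvDl, dotvDr, dotvNl, dotvNr, dotvZl, dotvZr).

Lemma dotv_ge0 u : 0 <= dotv u u.
Proof.
by rewrite /dotv mxE; apply: sumr_ge0 => i _; rewrite !mxE -expr2 sqr_ge0.
Qed.

Lemma sqr_norm2 u : norm2 u ^+ 2 = dotv u u.
Proof. by rewrite /norm2 sqr_sqrtr ?dotv_ge0. Qed.

Lemma young_dotv c k u v : 0 < c ->
  2 * k * dotv u v <= c * dotv u u + k ^+ 2 / c * dotv v v.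
Proof.
move=> c0; rewrite -subr_ge0.
have -> : c * dotv u u + k ^+ 2 / c * dotv v v - 2 * k * dotv u v =
    c^-1 * dotv (c *: u - k *: v) (c *: u - k *: v).
  by rewrite !dotvE (dotvC v u); field; rewrite gt_eqF.
by rewrite mulr_ge0 ?dotv_ge0 // invr_ge0 ltW.
Qed.

(** The square [|w - (y - e)|^2] is that of the input received through a channel
    that carries the held value [y - e] of the signal [y].  For [nu >= 0] its
    term is favourable and can be dropped.  For [nu < 0] it is expanded, and the
    part [- nu + a] of [- eps |w|^2], where [a := nu - |nu| - eps], pays for the
    cross terms with [w]: the share [a] for [w^T y], at the price
    [nu ^ 2 / a |y|^2], and the share [- nu] for [w^T e], at the price
    [- nu |e|^2].  With [y^T e] split evenly, the total cost is
    [- 2 nu |y|^2 - 3 nu |e|^2], which is the third case of [beta]. *)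
Lemma channel_dissipation nu rho delta eps w y e :
  0 <= delta -> eps < nu - `|nu| -> dotv e e <= delta * dotv y y ->
  - nu * dotv (w - (y - e)) (w - (y - e)) + eps * dotv w w + dotv e e <=
  (rho - beta rho delta nu + nu ^+ 2 / (nu - `|nu| - eps)) * dotv y y.
Proof.
move=> delta0 epslt ele.
have y0 := dotv_ge0 y; have w0 := dotv_ge0 w; have u0 := dotv_ge0 (w - (y - e)).
have a0 : 0 < nu - `|nu| - eps by rewrite subr_gt0.
have q0 : 0 <= nu ^+ 2 / (nu - `|nu| - eps) * dotv y y.
  by rewrite mulr_ge0 // divr_ge0 ?sqr_ge0 // ltW.
rewrite mulrDl /beta; case: (ltgtP 0 nu) => [nu0|nu0|nu0].
- rewrite gtr0_norm // subrr sub0r oppr_gt0 in a0.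
  have := mulr_ge0 (ltW nu0) u0; have := mulr_ge0 (ltW nu0) y0.
  have := mulr_ge0 (mulr_ge0 delta0 (ltW nu0)) y0.
  have : eps * dotv w w <= 0 by rewrite mulr_le0_ge0 // ltW.
  by move: q0 ele; set q := _ / _ * _; lra.
- have wy := young_dotv (nu - `|nu| - eps) nu w y a0.
  have Nnu0 : 0 < - nu by rewrite oppr_gt0.
  have we := young_dotv (- nu) (- nu) w e Nnu0.
  have ye := young_dotv (- nu) nu y e Nnu0.
  have ENnu : (- nu) ^+ 2 / - nu = - nu by field; rewrite lt_eqF.
  rewrite sqrrN in ENnu; rewrite sqrrN ENnu in we; rewrite ENnu in ye.
  have nue : - nu * dotv e e <= - nu * (delta * dotv y y).
    by rewrite ler_pM2l.
  have normE : `|nu| = - nu by rewrite ltr0_norm.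
  rewrite !dotvE (dotvC y w) (dotvC e w) (dotvC e y).
  move: wy q0; set q := _ / _; rewrite normE; lra.
- rewrite -nu0 normr0 subrr sub0r oppr_gt0 in a0 *.
  have : eps * dotv w w <= 0 by rewrite mulr_le0_ge0 // ltW.
  by rewrite expr0n mul0r; lra.
Qed.

End EuclideanProduct.

Lemma dotv_split {R : realType} {m : nat} (u v : 'cV[R]_(m + m)) :
  dotv u v = dotv (usubmx u) (usubmx v) + dotv (dsubmx u) (dsubmx v).
Proof.
by rewrite -{1}(vsubmxK u) -{1}(vsubmxK v) /dotv tr_col_mx mul_row_col mxE.
Qed.

(** Strictly between an event instant and the next one the violation set has no
    element, since [s k.+1] is its infimum; at the instant itself the error
    vanishes, and the bound holds because [delta] is nonnegative. *)
Lemma sampling_error_le {R : realType} {m : nat} {T : \bar R} {delta : R}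
    {y yh : R -> 'cV[R]_m} {s : nat -> \bar R} (t : R) :
  0 <= delta -> event_instants T delta y s -> held T y s yh -> horizon T t ->
  dotv (y t - yh t) (y t - yh t) <= delta * dotv (y t) (y t).
Proof.
move=> delta0 [_ next cover] hold Tt.
have [k [skt tsk]] := cover t Tt.
rewrite (hold k t Tt skt tsk) -!sqr_norm2 leNgt; apply/negP => viol.
move: skt; rewrite le_eqVlt => /orP[/eqP skE|skt].
  move: viol; rewrite skE /= subrr !sqr_norm2 {2}/dotv mulmx0 mxE.
  by rewrite ltNge mulr_ge0 ?dotv_ge0.
move: tsk; rewrite next ltNge => /negP; apply.
by apply: ereal_inf_lbound; exists t => //; split => //; case: Tt.
Qed.

Lemma right_derivativeD {R : realType} {E : normedModType R} (f g : R -> E)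
    (t : R) (df dg : E) :
  right_derivative f t df -> right_derivative g t dg ->
  right_derivative (fun s => f s + g s) t (df + dg).
Proof.
move=> hf hg; apply: cvg_trans (cvgD hf hg); apply: near_eq_cvg.
by apply: nearW => h /=; rewrite opprD addrACA scalerDr.
Qed.

Lemma storage_functionD {R : realType} {E F : normedModType R} (X : set E)
    (Y : set F) (V : E -> R) (W : F -> R) :
  storage_function X V -> storage_function Y W ->
  storage_function (X `*` Y) (fun z => V z.1 + W z.2).
Proof.
move=> hV hW [x z] [/= /hV[V0 dV] /hW[W0 dW]]; split; first exact: addr_ge0.
apply: differentiableD.
- apply: (@differentiable_comp _ _ _ _ fst V) => //.
  by apply: linear_differentiable => p; exact: cvg_fst.
- apply: (@differentiable_comp _ _ _ _ snd W) => //.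
  by apply: linear_differentiable => p; exact: cvg_snd.
Qed.

Theorem theorem11 (R : realType) (np nc m : nat)
    (Gp : system R np m) (Gc : system R nc m)
    (nu_p rho_p nu_c rho_c delta_p delta_c eps0 delta0 : R)
    (hGp : IF_OFP Gp nu_p rho_p) (hGc : IF_OFP Gc nu_c rho_c)
    (hdelta_p : 0 < delta_p <= 1) (hdelta_c : 0 < delta_c <= 1)
    (heps0 : eps0 < Num.min (nu_c - `|nu_c|) (nu_p - `|nu_p|))
    (hdelta0 : delta0 < Num.min
       (beta rho_p delta_p nu_c - 1 / 4
          - nu_c ^+ 2 / (nu_c - `|nu_c| - eps0))
       (beta rho_c delta_c nu_p - 1 / 4
          - nu_p ^+ 2 / (nu_p - `|nu_p| - eps0))) :
  passive_with_indices (state_set Gp `*` state_set Gc)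
    (event_triggered_loop Gp Gc delta_p delta_c) eps0 delta0.
Proof.
have [Vp storeVp dissVp] := hGp; have [Vc storeVc dissVc] := hGc.
move: heps0 hdelta0; rewrite !lt_min => /andP[epsc epsp] /andP[deltac deltap].
have [/andP[/ltW dp0 _] /andP[/ltW dc0 _]] := (hdelta_p, hdelta_c).
exists (fun z => Vp z.1 + Vc z.2); first exact: storage_functionD.
move=> T x w y [tp [tc [yph [ych [[evp evc hp hc] [solp solc]]]]]] t Tt.
have [dVp rdVp leVp] := dissVp _ _ _ _ solp t Tt.
have [dVc rdVc leVc] := dissVc _ _ _ _ solc t Tt.
exists (dVp + dVc); first exact: right_derivativeD rdVp rdVc.
have errp := sampling_error_le t dp0 evp hp Tt.
have errc := sampling_error_le t dc0 evc hc Tt.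
rewrite !dotv_split.
move: leVp leVc errp errc; set w1 := usubmx (w t); set w2 := dsubmx (w t).
set yp := usubmx (y t); set yc := dsubmx (y t).
set ep := yp - yph t; set ec := yc - ych t.
have -> : ych t = yc - ec by rewrite /ec subKr.
have -> : yph t = yp - ep by rewrite /ep subKr.
clearbody ep ec => leVp leVc errp errc.
have chc := channel_dissipation nu_p rho_c delta_c eps0 w1 yc ec dc0 epsp errc.
(* The loop has negative feedback only at the plant input, so at the controller
   input the channel carries [- yp], with error [- ep]. *)
have errNp : dotv (- ep) (- ep) <= delta_p * dotv (- yp) (- yp).
  by rewrite !dotvE !opprK.
have := channel_dissipation nu_c rho_p delta_p eps0 w2 (- yp) (- ep)
  dp0 epsc errNp.
have -> : w2 - (- yp - - ep) = w2 + (yp - ep) by rewrite -opprD opprK.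
rewrite !(dotvNl, dotvNr, opprK) => chp.
have crossc := young_dotv 1 (1 / 2) ec yp ltr01.
have crossp := young_dotv 1 (- (1 / 2)) ep yc ltr01.
have yp0 := dotv_ge0 yp; have yc0 := dotv_ge0 yc.
have supply : dotv (w1 - (yc - ec)) yp + dotv (w2 + (yp - ep)) yc =
    dotv w1 yp + dotv w2 yc + dotv ec yp - dotv ep yc.
  by rewrite !dotvE (dotvC yp yc); ring.
have := ler_wpM2r yp0 (ltW deltac); have := ler_wpM2r yc0 (ltW deltap).
move: chp chc crossp crossc supply leVp leVc.
set qc := _ / (nu_c - _ - _); set qp := _ / (nu_p - _ - _).
lra.
Qed.
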